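(* Let $X$ be $\mathbb{R}^2$ endowed with an absolute and symmetric norm. Let $x_0\in S_X$ and $x_0^*\in S_{X^*}$ be such that $x_0^*(x_0)=1$ and $|x_0^*(I_4 x_0)|=v(I_4)$, and write $c_j=|x_0^*(I_jx_0)|$ for every $j=1,\ldots,4$. If $c_4=0$, then $n(X)=0$. If otherwise $c_4>0$, then $$ n(X)\geq\min\left\{c_4,\dfrac{2}{1+\frac{1}{c_2}+\frac{1}{c_3}+\frac{1}{c_4}} \right\}. $$ Moreover, if (in the case $c_4>0$) the inequality $c_4\left(1+\frac{1}{c_2}+\frac{1}{c_3}\right)\leq 1$ holds, then $$ n(X)=v(I_4). $$
   Context: A norm $\|\cdot\|$ on $\mathbb{R}^2$ is absolute if $\|(1,0)\|=\|(0,1)\|=1$ and $\|(a,b)\|=\|(|a|,|b|)\|$ for all $a,b\in\mathbb{R}$; it is symmetric if $\|(b,a)\|=\|(a,b)\|$ for all $a,b\in\mathbb{R}$. For a real Banach space $X$, $X^*$ is its topological dual with the dual norm, $S_X$ and $S_{X^*}$ are the unit spheres of $X$ and $X^*$, and $\mathcal{L}(X)$ is the space of bounded linear operators on $X$ with the operator norm. For $T\in\mathcal{L}(X)$, the numerical radius is $$v(T)=\sup\{|x^*(Tx)| : x^*\in X^*,\ x\in X,\ \|x^*\|=\|x\|=x^*(x)=1\},$$ and the numerical index of $X$ is $n(X)=\inf\{v(T): T\in\mathcal{L}(X),\ \|T\|=1\}$. The operators $I_1,\dots,I_4$ on $\mathbb{R}^2$ are those represented by the matrices $$ I_1=\begin{pmatrix}1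 & 0\\0 & 1\end{pmatrix},\quad I_2=\begin{pmatrix}1 & 0\\0 & -1\end{pmatrix},\quad I_3=\begin{pmatrix}0 & 1\\1 & 0\end{pmatrix},\quad I_4=\begin{pmatrix}0 & 1\\-1 & 0\end{pmatrix}. $$ *)

(* Defs.v *)
From HB Require Import structures.
From mathcomp Require Import all_boot all_order all_algebra.
From mathcomp Require Import all_classical all_reals all_analysis.

Set Implicit Arguments.
Unset Strict Implicit.
Unset Printing Implicit Defensive.

Import Order.TTheory GRing.Theory Num.Theory.
Import numFieldNormedType.Exports.

Local Open Scope classical_set_scope.
Local Open Scope ring_scope.

Section NumericalIndex.
Variable R : realType.

Definition opnorm (V W : normedModType R) (f : {linear V -> W}) : R :=
  sup [set `|f x| | x in [set x : V | `|x| <= 1]].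

Definition unit_sphere (X : normedModType R) : set X := [set x | `|x| = 1].

Definition dual_unit_sphere (X : normedModType R) : set {linear X -> R^o} :=
  [set f : {linear X -> R^o} | continuous f /\ opnorm f = 1].

(* The real-valued [sup] and [inf] return 0 on sets without a supremum or
   infimum. If X is nonzero and T is bounded, the set in [numerical_radius] is
   nonempty and bounded above; the set in [numerical_index] is nonempty and
   bounded below by 0. *)
Definition numerical_radius (X : normedModType R) (T : {linear X -> X}) : R :=
  sup [set r | exists (f : {linear X -> R^o}) (x : X),
    [/\ dual_unit_sphere f, unit_sphere x, f x = 1 & r = `|f (T x)|]].

Definition numerical_index (X : normedModType R) : R :=
  inf [set numerical_radius T | T in
    [set T : {linear X -> X} | bounded_fun_norm T /\ opnorm T = 1]].

End NumericalIndex.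

Record norm_on (R : realType) (V : lmodType R) := NormOn {
  norm_fun :> V -> R;
  norm_triangle : forall x y, norm_fun (x + y) <= norm_fun x + norm_fun y;
  norm_homogeneous : forall (l : R) x, norm_fun (l *: x) = `|l| * norm_fun x;
  norm_definite : forall x, norm_fun x = 0 -> x = 0
}.

(* [plane N] is R^2 with the norm N. It has to be an alias: the type 'cV[R]_2
   already carries the max norm of the library. *)
Definition plane (R : realType) (N : norm_on 'cV[R]_2) : Type := 'cV[R]_2.

HB.instance Definition _ (R : realType) (N : norm_on 'cV[R]_2) :=
  GRing.Lmodule.copy (plane N) 'cV[R]_2.

HB.instance Definition _ (R : realType) (N : norm_on 'cV[R]_2) :=
  @Lmodule_isNormed.Build R (plane N) N
    (@norm_triangle R _ N) (@norm_homogeneous R _ N) (@norm_definite R _ N).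

Section Plane.
Variable R : realType.

Definition vec2 (a b : R) : 'cV[R]_2 := \col_i (if i == 0 then a else b).

Definition mat2 (a b c d : R) : 'M[R]_2 :=
  \matrix_(i, j) (if i == 0 then (if j == 0 then a else b)
                  else (if j == 0 then c else d)).

Definition absolute_norm (N : norm_on 'cV[R]_2) : Prop :=
  [/\ N (vec2 1 0) = 1, N (vec2 0 1) = 1
    & forall a b, N (vec2 a b) = N (vec2 `|a| `|b|)].

Definition symmetric_norm (N : norm_on 'cV[R]_2) : Prop :=
  forall a b, N (vec2 b a) = N (vec2 a b).

Definition mxop (N : norm_on 'cV[R]_2) (A : 'M[R]_2) (x : plane N) : plane N :=
  A *m x.

Fact mxop_is_linear (N : norm_on 'cV[R]_2) (A : 'M[R]_2) :
  linear (@mxop N A).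
Proof. by move=> k x y; exact: (linearP (mulmx A)). Qed.

HB.instance Definition _ (N : norm_on 'cV[R]_2) (A : 'M[R]_2) :=
  GRing.isLinear.Build R (plane N) (plane N) *:%R (@mxop N A)
    (@mxop_is_linear N A).

Variable N : norm_on 'cV[R]_2.

Definition I2 : {linear plane N -> plane N} := @mxop N (mat2 1 0 0 (-1)).
Definition I3 : {linear plane N -> plane N} := @mxop N (mat2 0 1 1 0).
Definition I4 : {linear plane N -> plane N} := @mxop N (mat2 0 1 (-1) 0).

End Plane.

(* Main.v *)
Require Import Defs.
From HB Require Import structures.
From mathcomp Require Import all_boot all_order all_algebra.
From mathcomp Require Import all_classical all_reals all_analysis.
From mathcomp Require Import ring lra.

Set Implicit Arguments.
Unset Strict Implicit.
Unset Printing Implicit Defensive.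

Import Order.TTheory GRing.Theory Num.Theory.
Import numFieldNormedType.Exports.

Local Open Scope classical_set_scope.
Local Open Scope ring_scope.

(* Every operator is a1 I1 + a2 I2 + a3 I3 + a4 I4. The isometries I2 and I3
   act on it by conjugation, flipping the signs of two of the coefficients
   a2, a3, a4. Evaluating at (x0, x0s) and its images under these isometries
   thus bounds v(T) from below by every |a1 +- a2 c2 +- a3 c3 +- a4 c4| with an
   even number of minus signs (up to the signs of the c_j), hence by
   s - 2 min_j |a_j| c_j with s = sum_j |a_j| c_j and c1 = 1. As each I_j is an
   isometry, ||T|| <= sum_j |a_j|, and what remains is linear programming, using
   c4 <= c1, c2, c3. The last inequalities follow from c_j <= 1 and the identity
   1 + c4^2 = c2^2 + c3^2; they also show that c2, c3 > 0 when c4 > 0. *)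

(** * Linear inequalities behind the lower bound *)

(** Up to a global sign, the hypotheses cover all patterns with an even number of minus signs.
    Either the signs of the [b_j] form such a pattern, or changing any one of them does, at a cost
    of twice that [|b_j|]. *)
Lemma sub_twice_le_of_sign_patterns (R : realType) (v b1 b2 b3 b4 : R) :
  `|b1 + b2 + b3 + b4| <= v -> `|b1 + b2 - b3 - b4| <= v ->
  `|b1 - b2 + b3 - b4| <= v -> `|b1 - b2 - b3 + b4| <= v ->
  let s := `|b1| + `|b2| + `|b3| + `|b4| in
  [/\ s - 2 * `|b1| <= v, s - 2 * `|b2| <= v,
      s - 2 * `|b3| <= v & s - 2 * `|b4| <= v].
Proof.
rewrite !ler_norml => /andP[? ?] /andP[? ?] /andP[? ?] /andP[? ?] /=.
case: (ger0P b1) => ?; case: (ger0P b2) => ?;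
  case: (ger0P b3) => ?; case: (ger0P b4) => ?; split; lra.
Qed.

(** Here [t] is the smallest of the four variables. The gap between the two sides is an explicit sum
    of products of nonnegative factors. *)
Lemma weighted_sum_le_of_min (R : realType) (M u1 u2 u3 u4 t b2 b3 b4 : R) :
  u1 <= M -> u2 <= M -> u3 <= M -> u4 <= M -> u1 + u2 + u3 + u4 <= 2 * M ->
  0 <= t -> t <= b2 -> t <= b3 -> t <= b4 ->
  u1 * t + u2 * b2 + u3 * b3 + u4 * b4 <= M * (b2 + b3 + b4 - t).
Proof.
move=> h1 h2 h3 h4 hS t0 tb2 tb3 tb4; rewrite -subr_ge0.
have -> : M * (b2 + b3 + b4 - t) - (u1 * t + u2 * b2 + u3 * b3 + u4 * b4) =
  (M - u2) * (b2 - t) + (M - u3) * (b3 - t) + (M - u4) * (b4 - t) +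
  (2 * M - (u1 + u2 + u3 + u4)) * t by ring.
by rewrite !addr_ge0 // mulr_ge0 // subr_ge0.
Qed.

(** Meant for [u_j] = 1/c_j and [b_j] = |a_j| c_j, where the left side becomes the sum of the
    |a_j|. *)
Lemma weighted_sum_le (R : realType) (M v u1 u2 u3 u4 b1 b2 b3 b4 : R) :
  u1 <= M -> u2 <= M -> u3 <= M -> u4 <= M -> u1 + u2 + u3 + u4 <= 2 * M ->
  0 <= M -> 0 <= b1 -> 0 <= b2 -> 0 <= b3 -> 0 <= b4 ->
  let s := b1 + b2 + b3 + b4 in
  s - 2 * b1 <= v -> s - 2 * b2 <= v -> s - 2 * b3 <= v -> s - 2 * b4 <= v ->
  u1 * b1 + u2 * b2 + u3 * b3 + u4 * b4 <= M * v.
Proof.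
move=> h1 h2 h3 h4 hS M0 p1 p2 p3 p4 /= v1 v2 v3 v4.
have Mle t : t <= v -> M * t <= M * v by exact: ler_wpM2l.
(* The comparisons locate the smallest [b_j], which then takes the place of [t]. *)
have [l12|l21] := leP b1 b2; have [l34|l43] := leP b3 b4.
- have [l13|l31] := leP b1 b3.
    have := Mle (b2 + b3 + b4 - b1) ltac:(lra).
    have := @weighted_sum_le_of_min _ M u1 u2 u3 u4 b1 b2 b3 b4; lra.
  have := Mle (b1 + b2 + b4 - b3) ltac:(lra).
  have := @weighted_sum_le_of_min _ M u3 u1 u2 u4 b3 b1 b2 b4; lra.
- have [l14|l41] := leP b1 b4.
    have := Mle (b2 + b3 + b4 - b1) ltac:(lra).
    have := @weighted_sum_le_of_min _ M u1 u2 u3 u4 b1 b2 b3 b4; lra.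
  have := Mle (b1 + b2 + b3 - b4) ltac:(lra).
  have := @weighted_sum_le_of_min _ M u4 u1 u2 u3 b4 b1 b2 b3; lra.
- have [l23|l32] := leP b2 b3.
    have := Mle (b1 + b3 + b4 - b2) ltac:(lra).
    have := @weighted_sum_le_of_min _ M u2 u1 u3 u4 b2 b1 b3 b4; lra.
  have := Mle (b1 + b2 + b4 - b3) ltac:(lra).
  have := @weighted_sum_le_of_min _ M u3 u1 u2 u4 b3 b1 b2 b4; lra.
- have [l24|l42] := leP b2 b4.
    have := Mle (b1 + b3 + b4 - b2) ltac:(lra).
    have := @weighted_sum_le_of_min _ M u2 u1 u3 u4 b2 b1 b3 b4; lra.
  have := Mle (b1 + b2 + b3 - b4) ltac:(lra).
  have := @weighted_sum_le_of_min _ M u4 u1 u2 u3 b4 b1 b2 b3; lra.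
Qed.

(** * Operator norms, numerical radius and norming pairs *)

Section NumericalRange.
Variables (R : realType) (X : normedModType R).
Implicit Types (f : {linear X -> R^o}) (T U : {linear X -> X}) (x : X).

(* [sup] is 0 on sets without a supremum, so [opnorm f = 1] forces the
   supremum to exist. *)
Lemma opnorm1_bounded (W : normedModType R) (f : {linear X -> W}) x :
  opnorm f = 1 -> `|x| <= 1 -> `|f x| <= 1.
Proof.
move=> f1 x1; rewrite -f1; apply: ub_le_sup; last by exists x.
set E := [set `|f x| | x in _]; have [[_ //]|no_sup] := pselect (has_sup E).
by move: f1 (oner_neq0 R); rewrite /opnorm -/E sup_out // => <-; rewrite eqxx.
Qed.

Lemma opnorm_le (W : normedModType R) (f : {linear X -> W}) M :
  (forall x, `|x| <= 1 -> `|f x| <= M) -> opnorm f <= M.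
Proof.
move=> fM; apply: ge_sup; first by exists `|f 0|, 0; rewrite //= normr0.
by move=> _ [x x1 <-]; exact: fM.
Qed.

Lemma opnorm_isometry (T : {linear X -> X}) x :
  `|x| = 1 -> (forall y, `|T y| = `|y|) -> opnorm T = 1.
Proof.
move=> x1 Tiso; apply/eqP; rewrite eq_le; apply/andP; split.
  by apply: opnorm_le => y; rewrite Tiso.
apply: ub_le_sup; last by exists x; rewrite /= ?x1 // Tiso.
by exists 1 => _ [y y1 <-]; rewrite Tiso.
Qed.

Definition norming f x := [/\ dual_unit_sphere f, unit_sphere x & f x = 1].

Lemma norming_le f x y : norming f x -> `|y| <= 1 -> `|f y| <= 1.
Proof. by move=> [[_ f1] _ _]; exact: opnorm1_bounded. Qed.

Lemma le_numerical_radius T f x :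
  opnorm T = 1 -> norming f x -> `|f (T x)| <= numerical_radius T.
Proof.
move=> T1 fx; apply: ub_le_sup; last first.
  by case: fx => f1 x1 fx1; exists f, x.
(* The bound 1 ensures that the supremum is not the default value. *)
exists 1 => _ [g [y [g1 y1 gy ->]]].
by apply: (@norming_le g y) => //; apply: opnorm1_bounded => //; rewrite y1.
Qed.

Lemma numerical_radius_ge0 T : 0 <= numerical_radius T.
Proof.
rewrite /numerical_radius; set E := [set r | _].
(* Without a supremum, [sup] is 0 and the claim is trivial. *)
have [[[r Er] Eub]|/sup_out -> //] := pselect (has_sup E).
apply: le_trans (ub_le_sup Eub Er); case: Er => f [x [_ _ _ ->]].
exact: normr_ge0.
Qed.

Lemma numerical_index_le T :
  bounded_fun_norm T -> opnorm T = 1 -> numerical_index X <= numerical_radius T.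
Proof.
move=> Tb T1; apply: ge_inf; last by exists T.
by exists 0 => _ [S _ <-]; exact: numerical_radius_ge0.
Qed.

(** [T] only witnesses that the infimum is over a nonempty set. *)
Lemma le_numerical_index T m :
  bounded_fun_norm T -> opnorm T = 1 ->
  (forall S : {linear X -> X}, opnorm S = 1 -> m <= numerical_radius S) ->
  m <= numerical_index X.
Proof.
move=> Tb T1 mle; apply: lb_le_inf; first by exists (numerical_radius T), T.
by move=> _ [S [_ S1] <-]; exact: mle.
Qed.

Lemma isometry_bounded_fun_norm T :
  (forall x, `|T x| = `|x|) -> bounded_fun_norm T.
Proof. by move=> Tiso r; exists r => x; rewrite Tiso. Qed.

Lemma isometry_continuous T : (forall x, `|T x| = `|x|) -> continuous T.
Proof.
move=> Tiso; apply/linear_bounded_continuous/linear_boundedP.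
near=> r => x; rewrite Tiso ler_peMl //; near: r.
Unshelve. all: by end_near. Qed.

(** [U] permutes the unit ball, so composing with it preserves the dual norm. Since f (U (T (U x)))
    is the value of [T] at the new pair, conjugates of [T] can be tested at the original pair. *)
Lemma norming_involution U f x :
  (forall y, `|U y| = `|y|) -> (forall y, U (U y) = y) ->
  norming f x -> norming (f \o U) (U x).
Proof.
move=> Uiso UK [[fc f1] x1 fx1]; split; last by rewrite /= UK.
  split; last first.
    rewrite -f1 /opnorm; congr sup; apply/seteqP; split=> _ [y y1 <-] /=.
      by exists (U y) => //=; rewrite Uiso.
    by exists (U y); rewrite /= ?Uiso ?UK.
  by move=> y; apply: continuous_comp; [exact: isometry_continuous|exact: fc].
by rewrite /unit_sphere /= Uiso.
Qed.

End NumericalRange.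

(** * The isometries of the plane and the decomposition of operators *)

Section AbsolutePlane.
Variables (R : realType) (N : norm_on 'cV[R]_2).
Hypotheses (Nabs : absolute_norm N) (Nsym : symmetric_norm N).

Lemma vec2_eta (x : 'cV[R]_2) : x = vec2 (x 0 0) (x 1 0).
Proof.
by apply/colP => -[[|[|//]] i2]; rewrite mxE /=; congr (x _ _); apply: val_inj.
Qed.

Lemma mulmx_mat2_vec2 (a b c d u v : R) :
  mat2 a b c d *m vec2 u v = vec2 (a * u + b * v) (c * u + d * v).
Proof.
by apply/colP => i; rewrite !mxE big_ord_recl big_ord1 !mxE /=; case: ifP.
Qed.

Lemma I2_vec2 u v : I2 N (vec2 u v) = vec2 u (- v).
Proof. by rewrite /= /mxop mulmx_mat2_vec2; congr vec2; ring. Qed.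

Lemma I3_vec2 u v : I3 N (vec2 u v) = vec2 v u.
Proof. by rewrite /= /mxop mulmx_mat2_vec2; congr vec2; ring. Qed.

Lemma I4_vec2 u v : I4 N (vec2 u v) = vec2 v (- u).
Proof. by rewrite /= /mxop mulmx_mat2_vec2; congr vec2; ring. Qed.

Lemma norm_I2 (x : plane N) : `|I2 N x| = `|x|.
Proof.
have [_ _ Nab] := Nabs; rewrite [x]vec2_eta I2_vec2.
by rewrite /Num.norm /= Nab [RHS]Nab normrN.
Qed.

Lemma norm_I3 (x : plane N) : `|I3 N x| = `|x|.
Proof. by rewrite [x]vec2_eta I3_vec2; exact: Nsym. Qed.

Lemma I4E (x : plane N) : I4 N x = I2 N (I3 N x).
Proof. by rewrite [x]vec2_eta I4_vec2 I3_vec2 I2_vec2. Qed.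

Lemma norm_I4 (x : plane N) : `|I4 N x| = `|x|.
Proof. by rewrite I4E norm_I2 norm_I3. Qed.

Lemma I2K (x : plane N) : I2 N (I2 N x) = x.
Proof. by rewrite [x]vec2_eta !I2_vec2 opprK. Qed.

Lemma I3K (x : plane N) : I3 N (I3 N x) = x.
Proof. by rewrite [x]vec2_eta !I3_vec2. Qed.

Definition Icomb (a1 a2 a3 a4 : R) (x : plane N) : plane N :=
  a1 *: x + a2 *: I2 N x + a3 *: I3 N x + a4 *: I4 N x.

Lemma Icomb_vec2 a1 a2 a3 a4 u v :
  Icomb a1 a2 a3 a4 (vec2 u v) =
  vec2 ((a1 + a2) * u + (a3 + a4) * v) ((a3 - a4) * u + (a1 - a2) * v).
Proof.
rewrite /Icomb I2_vec2 I3_vec2 I4_vec2.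
by apply/colP => i; rewrite !mxE /=; case: ifP => _; ring.
Qed.

Lemma linear_Icomb (T : {linear plane N -> plane N}) :
  exists a1 a2 a3 a4, T =1 Icomb a1 a2 a3 a4.
Proof.
pose e1 : plane N := vec2 1 0; pose e2 : plane N := vec2 0 1.
have e12 u v : vec2 u v = u *: e1 + v *: e2.
  by apply/colP => i; rewrite !mxE; case: ifP => _; ring.
have vec2P (x : plane N) : exists u v, x = vec2 u v.
  by exists ((x : 'cV_2) 0 0), ((x : 'cV_2) 1 0); exact: vec2_eta.
have [t11 [t21 T1]] := vec2P (T e1); have [t12 [t22 T2]] := vec2P (T e2).
(* The solution of a1 + a2 = [t11], a1 - a2 = [t22], a3 + a4 = [t12], a3 - a4 = [t21]. *)
exists ((t11 + t22) / 2), ((t11 - t22) / 2), ((t12 + t21) / 2),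
  ((t12 - t21) / 2) => x.
have [u [v ->]] := vec2P x.
rewrite [in T _]e12 linearD !linearZ_LR T1 T2 Icomb_vec2.
by apply/colP => i; rewrite !mxE; case: ifP => _; field.
Qed.

(** [I2] is an involution that anticommutes with [I3] and [I4]. *)
Lemma I2_Icomb_I2 a1 a2 a3 a4 (x : plane N) :
  I2 N (Icomb a1 a2 a3 a4 (I2 N x)) = Icomb a1 a2 (- a3) (- a4) x.
Proof.
rewrite [x]vec2_eta I2_vec2 !Icomb_vec2 I2_vec2.
by congr vec2; ring.
Qed.

(** [I3] is an involution that anticommutes with [I2] and [I4]. *)
Lemma I3_Icomb_I3 a1 a2 a3 a4 (x : plane N) :
  I3 N (Icomb a1 a2 a3 a4 (I3 N x)) = Icomb a1 (- a2) a3 (- a4) x.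
Proof.
rewrite [x]vec2_eta I3_vec2 !Icomb_vec2 I3_vec2.
by congr vec2; ring.
Qed.

Lemma opnorm_Icomb (T : {linear plane N -> plane N}) a1 a2 a3 a4 :
  T =1 Icomb a1 a2 a3 a4 -> opnorm T <= `|a1| + `|a2| + `|a3| + `|a4|.
Proof.
move=> TE; apply: opnorm_le => x x1; rewrite TE /Icomb.
have Zle a y : `|y| = `|x| -> `|a *: y| <= `|a|.
  by move=> yx; rewrite normrZ yx ler_piMr.
do 3 (apply: le_trans (ler_normD _ _) _; apply: lerD;
  last by apply: Zle; rewrite ?norm_I2 ?norm_I3 ?norm_I4).
exact: Zle.
Qed.

End AbsolutePlane.

(** * The lower bound from one norming pair *)

Section LowerBound.
Variables (R : realType) (N : norm_on 'cV[R]_2).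
Hypotheses (Nabs : absolute_norm N) (Nsym : symmetric_norm N).
Variables (x : plane N) (f : {linear plane N -> R^o}).
Hypothesis fx : norming f x.

Let g2 : R := f (I2 N x).
Let g3 : R := f (I3 N x).
Let g4 : R := f (I4 N x).

Lemma norming_Icomb a1 a2 a3 a4 :
  f (Icomb a1 a2 a3 a4 x) = a1 + a2 * g2 + a3 * g3 + a4 * g4.
Proof.
have fZ a y : f (a *: y) = a * f y :> R by exact: linearZ_LR.
by have [_ _ f1] := fx; rewrite /Icomb !linearD !fZ f1 mulr1.
Qed.

Lemma norming_Icomb_le (T : {linear plane N -> plane N}) a1 a2 a3 a4 :
  T =1 Icomb a1 a2 a3 a4 -> opnorm T = 1 ->
  let b2 := a2 * g2 in let b3 := a3 * g3 in let b4 := a4 * g4 in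
  let v := numerical_radius T in
  [/\ `|a1 + b2 + b3 + b4| <= v, `|a1 + b2 - b3 - b4| <= v,
      `|a1 - b2 + b3 - b4| <= v & `|a1 - b2 - b3 + b4| <= v].
Proof.
move=> TE T1 /=.
have s2 := norming_involution (norm_I2 Nabs) (@I2K _ N) fx.
have s3 := norming_involution (norm_I3 Nsym) (@I3K _ N) fx.
have s23 := norming_involution (norm_I3 Nsym) (@I3K _ N) s2.
have := le_numerical_radius T1 fx; rewrite TE norming_Icomb => r1.
have : `|f (I2 N (T (I2 N x)))| <= numerical_radius T.
  exact: le_numerical_radius T1 s2.
rewrite TE I2_Icomb_I2 norming_Icomb !mulNr => r2.
have : `|f (I3 N (T (I3 N x)))| <= numerical_radius T.
  exact: le_numerical_radius T1 s3.
rewrite TE I3_Icomb_I3 norming_Icomb !mulNr => r3.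
(* Conjugating by both isometries flips a4 twice, so only a2 and a3 change sign. *)
have : `|f (I2 N (I3 N (T (I3 N (I2 N x)))))| <= numerical_radius T.
  exact: le_numerical_radius T1 s23.
rewrite TE I3_Icomb_I3 I2_Icomb_I2 norming_Icomb opprK !mulNr => r4.
by split.
Qed.

(** With x = (u, v), f = (p, q) and 1 = f(x)^2, both sides equal (u^2 + v^2)(p^2 + q^2), by the two
    forms of the two-square identity. *)
Lemma norming_coef_sq : 1 + g4 ^+ 2 = g2 ^+ 2 + g3 ^+ 2.
Proof.
have [p [q fE]] : exists p q : R, forall u v, f (vec2 u v) = u * p + v * q.
  exists (f (vec2 1 0)), (f (vec2 0 1)) => u v.
  rewrite -!linearZ_LR -linearD; congr (f _).
  by apply/colP => i; rewrite !mxE; case: ifP => _; ring.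
have [_ _ ] := fx.
rewrite /g2 /g3 /g4 [x]vec2_eta I2_vec2 I3_vec2 I4_vec2 !fE => f1.
by rewrite -[X in X + _](expr1n _ 2) -f1; ring.
Qed.

Lemma norming_coef_le :
  [/\ `|g4| <= 1, `|g4| <= `|g2| & `|g4| <= `|g3|].
Proof.
have x1 : `|x| <= 1 by have [_ -> _] := fx.
have le2 : `|g2| <= 1 by apply: (norming_le fx); rewrite norm_I2.
have le3 : `|g3| <= 1 by apply: (norming_le fx); rewrite norm_I3.
have le4 : `|g4| <= 1 by apply: (norming_le fx); rewrite norm_I4.
have := norming_coef_sq.
rewrite -(real_normK (num_real g2)) -(real_normK (num_real g3)).
rewrite -(real_normK (num_real g4)) => E.
have sq1 t : 0 <= t -> t <= 1 -> t ^+ 2 <= 1 :> R.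
  by move=> ? ?; rewrite expr_le1.
have := sq1 _ (normr_ge0 g2) le2; have := sq1 _ (normr_ge0 g3) le3.
by split => //; rewrite -ler_sqr ?nnegrE //; lra.
Qed.

Lemma norming_lower_bound (T : {linear plane N -> plane N}) :
  opnorm T = 1 -> 0 < `|g4| ->
  Num.min `|g4| (2 / (1 + 1 / `|g2| + 1 / `|g3| + 1 / `|g4|))
    <= numerical_radius T.
Proof.
move=> T1 c4_gt0; have [a1 [a2 [a3 [a4 TE]]]] := linear_Icomb T.
have [le41 le42 le43] := norming_coef_le.
have c2_gt0 := lt_le_trans c4_gt0 le42; have c3_gt0 := lt_le_trans c4_gt0 le43.
have [/= h1 h2 h3 h4] := norming_Icomb_le TE T1.
have [/= k1 k2 k3 k4] := sub_twice_le_of_sign_patterns h1 h2 h3 h4.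
move: k1 k2 k3 k4; rewrite !normrM; set v := numerical_radius T => k1 k2 k3 k4.
have := opnorm_Icomb Nabs Nsym TE; rewrite T1 => ge1.
rewrite !div1r.
have u1 : 1 <= `|g4|^-1 by rewrite invf_ge1.
have u2 : `|g2|^-1 <= `|g4|^-1 by rewrite lef_pV2 // posrE.
have u3 : `|g3|^-1 <= `|g4|^-1 by rewrite lef_pV2 // posrE.
have u2_gt0 : 0 < `|g2|^-1 by rewrite invr_gt0.
have u3_gt0 : 0 < `|g3|^-1 by rewrite invr_gt0.
set S := 1 + _ + _ + _.
have S_gt0 : 0 < S by rewrite /S; lra.
(* Since 1/c4 is the largest of the 1/c_j, these two conditions on [M] are all that
   [weighted_sum_le] asks. *)
have key M : `|g4|^-1 <= M -> S <= 2 * M -> 1 <= M * v.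
  move=> uM SM; apply: (le_trans ge1).
  have VK c a : 0 < c -> c^-1 * (a * c) = a :> R.
    by move=> c_gt0; rewrite mulrCA mulVf ?mulr1 // gt_eqF.
  rewrite -(mul1r `|a1|) -(VK _ `|a2| c2_gt0) -(VK _ `|a3| c3_gt0).
  rewrite -(VK _ `|a4| c4_gt0).
  by apply: weighted_sum_le; rewrite ?mulr_ge0 ?(le_trans _ uM) ?invr_ge0.
(* The best [M] is the larger of 1/c4 and [S]/2, whose inverse is the minimum in the statement. *)
rewrite ge_min; have [le|lt] := leP S (2 * `|g4|^-1).
  have := key _ (lexx _) le.
  by rewrite mulrC ler_pdivlMr // mul1r => ->.
have := key (S / 2) ltac:(lra) ltac:(lra).
by rewrite ler_pdivrMr // mulrAC ler_pdivlMr // mul1r mulrC => ->; rewrite orbT.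
Qed.

End LowerBound.

Theorem theorem2 (R : realType) (N : norm_on 'cV[R]_2)
    (x0 : plane N) (x0s : {linear plane N -> R^o}) :
  absolute_norm N -> symmetric_norm N ->
  unit_sphere x0 -> dual_unit_sphere x0s -> x0s x0 = 1 ->
  `|x0s (I4 N x0)| = numerical_radius (I4 N) ->
  let c (T : {linear plane N -> plane N}) : R := `|x0s (T x0)| in
  let c2 := c (I2 N) in
  let c3 := c (I3 N) in
  let c4 := c (I4 N) in
  (c4 = 0 -> numerical_index (plane N) = 0) /\
  (0 < c4 ->
     numerical_index (plane N)
       >= Num.min c4 (2 / (1 + 1 / c2 + 1 / c3 + 1 / c4)) /\
     (c4 * (1 + 1 / c2 + 1 / c3) <= 1 ->
        numerical_index (plane N) = numerical_radius (I4 N))).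
Proof.
move=> Nabs Nsym x1 f1 fx1 vI4 c c2 c3 c4.
have fx : norming x0s x0 by [].
have I4b := isometry_bounded_fun_norm (norm_I4 Nabs Nsym).
have I41 := opnorm_isometry x1 (norm_I4 Nabs Nsym).
(* [I4] has norm one, so it competes in the infimum. *)
have n_le : numerical_index (plane N) <= c4.
  by rewrite /c4 /c vI4; exact: numerical_index_le.
split=> [c40|c4_gt0].
  apply/eqP; rewrite eq_le -{1}c40 n_le /=.
  by apply: le_numerical_index I4b I41 _ => T _; exact: numerical_radius_ge0.
have lower : Num.min c4 (2 / (1 + 1 / c2 + 1 / c3 + 1 / c4))
    <= numerical_index (plane N).
  by apply: le_numerical_index I4b I41 _ => T T1; exact: norming_lower_bound.
split=> // hc; apply/eqP; rewrite -vI4 eq_le n_le /=.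
apply: le_trans lower; rewrite le_min lexx /=.
have [_ le42 le43] := norming_coef_le Nabs Nsym fx.
have u2 : 0 < 1 / c2 by rewrite div1r invr_gt0; exact: lt_le_trans le42.
have u3 : 0 < 1 / c3 by rewrite div1r invr_gt0; exact: lt_le_trans le43.
have u4 : 0 < 1 / c4 by rewrite div1r invr_gt0.
(* Clearing the denominator leaves c4 (1 + 1/c2 + 1/c3) + 1 <= 2, which is [hc]; so the minimum is
   [c4]. *)
rewrite ler_pdivlMr; last by lra.
by rewrite mulrDr [c4 * (1 / c4)]mulrCA mulfV ?gt_eqF // mulr1 lerD.
Qed.
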